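(* Let $(G_a,\circ)$ be a commutative group (in the usual, associative sense) of odd order $2n+1$, and let $\alpha\in\mathbb{N}$ be such that both $\alpha$ and $\alpha-1$ are coprime to $2n+1$. Then the set $G_a$ with the composition $$a.b=a^{\alpha}\circ b^{1-\alpha}\qquad(a,b\in G_a)$$ is a distributive group of order $2n+1$.
   Context: A distributive group is a nonempty set $G$ with a binary operation $(a,b)\mapsto a.b$ on $G$ such that for all $a,b\in G$ each of the equations $a.x=b$ and $y.a=b$ has exactly one solution in $G$, and for all $a,b,c\in G$, $(a.b).c=(a.c).(b.c)$ and $c.(a.b)=(c.a).(c.b)$. Its order is its number of elements. The powers $a^{\alpha}$, $b^{1-\alpha}$ are taken in the group $(G_a,\circ)$. *)

(* Defs.v *)
From mathcomp Require Import all_boot all_order all_algebra.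

Set Implicit Arguments.
Unset Strict Implicit.
Unset Printing Implicit Defensive.

Import GRing.Theory.

Local Open Scope ring_scope.

Record distributive_group (G : Type) (op : G -> G -> G) : Prop :=
  DistributiveGroup {
    distributive_group_nonempty : inhabited G;
    distributive_group_divl : forall a b : G, exists! x : G, op a x = b;
    distributive_group_divr : forall a b : G, exists! y : G, op y a = b;
    distributive_group_distr : forall a b c : G,
      op (op a b) c = op (op a c) (op b c);
    distributive_group_distl : forall a b c : G,
      op c (op a b) = op (op c a) (op c b)
  }.

(* The commutative group is written additively, so a^alpha o b^(1 - alpha)
   reads alpha a + (1 - alpha) b; the exponent 1 - alpha is an integer, in
   general negative. *)
Definition power_op (G : zmodType) (alpha : nat) (a b : G) : G :=
  a *+ alpha + b *~ (1 - alpha%:Z).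

(* Main.v *)
Require Import Defs.
From mathcomp Require Import all_boot all_order all_algebra.

(** Both distributive laws follow from two identities valid in every
    commutative group: the operation is medial, because it is an additive
    function of the pair of its arguments, and it is idempotent, because its
    two coefficients add up to 1.  Hence (a.b).c = (a.b).(c.c) = (a.c).(b.c),
    and symmetrically on the other side.

    Solving a.x = b or y.a = b amounts to dividing one element of the group by
    1 - alpha or by alpha.  Such a division is possible in exactly one way
    when the divisor is coprime to the order of the group, since Bezout's
    identity provides an inverse modulo the order (bij_mulrz_coprime). *)

Import GRing.Theory.
Local Open Scope ring_scope.

Lemma power_op_medial (G : zmodType) (alpha : nat) (a b c d : G) :
  power_op alpha (power_op alpha a b) (power_op alpha c d) =
  power_op alpha (power_op alpha a c) (power_op alpha b d).
Proof.
rewrite /power_op !mulrnDl !mulrzDl !pmulrn -!mulrzA.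
by rewrite [(1 - _) * _]mulrC addrACA.
Qed.

Lemma power_op_idem (G : zmodType) (alpha : nat) (a : G) :
  power_op alpha a a = a.
Proof. by rewrite /power_op pmulrn -mulrzDr addrC subrK. Qed.

(** Translation by [x] permutes the group, so the sum of all elements equals
    itself plus [x *+ #|G|]. *)
Lemma mulrn_card (G : finZmodType) (x : G) : x *+ #|G| = 0.
Proof.
have: \sum_(y : G) y = \sum_(y : G) (x + y).
  by rewrite [LHS](reindex_inj (addrI x)).
by rewrite big_split /= sumr_const -[LHS]add0r => /addIr.
Qed.

Lemma bij_mulrz_coprime (G : finZmodType) (k : int) :
  coprimez k #|G|%:Z -> bijective (fun x : G => x *~ k).
Proof.
move=> /coprimezP[[u v] /= uv].
have inv (x : G) : x *~ (u * k) = x.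
  have vN0 : x *~ (v * #|G|%:Z) = 0.
    by rewrite mulrC mulrzA -pmulrn mulrn_card mul0rz.
  by rewrite -[LHS]addr0 -vN0 -mulrzDr uv.
by exists (fun x : G => x *~ u) => x; rewrite -mulrzA // mulrC.
Qed.

Lemma bij_exists_unique (A B : Type) (f : A -> B) (b : B) :
  bijective f -> exists! x, f x = b.
Proof. by case=> g fK gK; exists (g b); split=> // x <-. Qed.

Theorem mainTheorem2 (n alpha : nat) (G : finZmodType)
    (hG : #|G| = (2 * n + 1)%N)
    (halpha : coprime alpha (2 * n + 1))
    (halpha1 : coprimez (alpha%:Z - 1) (2 * n + 1)%N%:Z) :
  distributive_group (@power_op G alpha) /\ #|G| = (2 * n + 1)%N.
Proof.
split=> //; move: halpha halpha1; rewrite -hG => cop_alpha cop_alpha1.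
have bij_alpha : bijective (fun x : G => x *~ alpha%:Z).
  exact: bij_mulrz_coprime.
have bij_1alpha : bijective (fun x : G => x *~ (1 - alpha%:Z)).
  by apply: bij_mulrz_coprime; rewrite -opprB coprimeNz.
split.
- exact: (inhabits 0).
- move=> a b; apply: bij_exists_unique.
  apply: (bij_comp (f := +%R (a *+ alpha))) bij_1alpha.
  by exists (+%R (- (a *+ alpha))); [apply: addKr | apply: addNKr].
- move=> a b; apply: bij_exists_unique.
  apply: (bij_comp (f := +%R^~ (a *~ (1 - alpha%:Z)))) bij_alpha.
  by exists (+%R^~ (- (a *~ (1 - alpha%:Z)))); [apply: addrK | apply: subrK].
- by move=> a b c; rewrite -[in LHS](power_op_idem _ alpha c) power_op_medial.
- by move=> a b c; rewrite -[in LHS](power_op_idem _ alpha c) power_op_medial.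
Qed.
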